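(* Suppose there exist positive integer constants $d,c,N_0$ and a family $\{U_n\}_{n\ge N_0}$ of $\mathrm{QAC}^0$ circuits such that for each $n\ge N_0$, $U_n$ has depth $d$, $n$ input qubits and $n^c$ ancilla qubits, and computes $\mathrm{PARITY}_n$ with worst-case error $\mathrm{negl}(n)$. Then there exists $D=O(cd)$ such that for every $K\ge1$ and infinitely many $n$, one can construct a $\mathrm{QAC}^0$ circuit of depth $KD$, with $n$ input qubits and $n^{1+2^{-K}}$ ancilla qubits, which computes $\mathrm{PARITY}_n$ with worst-case error $\mathrm{negl}(n)$.
   Context: A depth-$d$ $\mathrm{QAC}^0$ circuit on $m$ qubits is a unitary $U=L_dM_d\cdots L_1M_1L_0$ where each $L_i$ is a tensor product of single-qubit unitaries and each $M_i$ is a tensor product of multi-qubit CZ gates $I-2|1^s\rangle\langle1^s|$ on pairwise disjoint sets of qubits. Ancilla qubits are initialized to $|0\rangle$. On input $x$, the circuit is applied to $|x\rangle\otimes|0^a\rangle$ and the first qubit is measured in the computational basis; worst-case error $\epsilon$ means the output differs from $\mathrm{PARITY}_n(x)=\bigoplus_ix_i$ with probability at most $\epsilon$ for every $x$. $\mathrm{negl}(n)$ denotes a function smaller than $n^{-c'}$ for every $c'$ and all large $n$. *)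

(* Defs.v *)
From HB Require Import structures.
From mathcomp Require Import all_boot all_order all_algebra.
From mathcomp Require Import all_classical all_reals all_analysis.
From mathcomp Require Import complex.
Set Implicit Arguments. Unset Strict Implicit. Unset Printing Implicit Defensive.
Import Order.TTheory GRing.Theory Num.Theory.
Local Open Scope ring_scope.

Section QAC.
Variable R : realType.
Local Notation C := R[i].

Definition basis (m : nat) := {ffun 'I_m -> bool}.

(* Operators on (C^2)^{\otimes m}, given by their matrix entries <x|A|y>. *)
Definition op (m : nat) := basis m -> basis m -> C.

Definition opmul m (A B : op m) : op m :=
  fun x y => \sum_(z : basis m) A x z * B z y.

(* A single-qubit gate, as a 2x2 matrix indexed by bool (false = |0>, true = |1>). *)
Definition qubit_gate := bool -> bool -> C.

Definition unitary1 (u : qubit_gate) : Prop :=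
  forall a b : bool, \sum_(k : bool) conjc (u k a) * u k b = (a == b)%:R.

Definition sq_layer m (g : 'I_m -> qubit_gate) : op m :=
  fun x y => \prod_(i < m) g i (x i) (y i).

(* Layer M = tensor product of multi-qubit CZ gates I - 2|1^s><1^s| on the
   (pairwise disjoint, nonempty) qubit sets S in P; identity elsewhere. *)
Definition cz_layer m (P : {set {set 'I_m}}) : op m :=
  fun x y => if x == y then
               \prod_(S in P) (if [forall i in S, x i] then -1 else 1)
             else 0.

Definition valid_cz m (P : {set {set 'I_m}}) : bool :=
  finset.trivIset P && (finset.set0 \notin P).

Definition valid_circuit m (d : nat) (sq : nat -> 'I_m -> qubit_gate)
    (cz : nat -> {set {set 'I_m}}) : Prop :=
  (forall k, (k <= d)%N -> forall i, unitary1 (sq k i)) /\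
  (forall k, (1 <= k <= d)%N -> valid_cz (cz k)).

Fixpoint circuit_op m (sq : nat -> 'I_m -> qubit_gate)
    (cz : nat -> {set {set 'I_m}}) (k : nat) : op m :=
  match k with
  | 0 => sq_layer (sq 0%N)
  | k'.+1 => opmul (sq_layer (sq k)) (opmul (cz_layer (cz k)) (circuit_op sq cz k'))
  end.

Definition init_state n a (x : {ffun 'I_n -> bool}) : basis (n + a) :=
  [ffun i => match fintype.split i with inl j => x j | inr _ => false end].

Definition first_bit m (y : basis m) : bool :=
  [exists i : 'I_m, (val i == 0%N) && y i].

Definition sqnorm (z : C) : R := complex.Re z ^+ 2 + complex.Im z ^+ 2.

Definition out_prob n a (U : op (n + a)) (x : {ffun 'I_n -> bool}) (b : bool) : R :=
  \sum_(y : basis (n + a) | first_bit y == b) sqnorm (U y (init_state a x)).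

Definition parity n (x : {ffun 'I_n -> bool}) : bool := \big[addb/false]_(i < n) x i.

Definition computes_parity n a (U : op (n + a)) (eps : R) : Prop :=
  forall x : {ffun 'I_n -> bool}, out_prob U x (~~ parity x) <= eps.

Definition QAC0_parity (d n a : nat) (eps : R) : Prop :=
  exists (sq : nat -> 'I_(n + a) -> qubit_gate) (cz : nat -> {set {set 'I_(n + a)}}),
    valid_circuit d sq cz /\ computes_parity (circuit_op sq cz d) eps.

Definition negl (eps : nat -> R) : Prop :=
  forall c' : nat, exists N : nat, forall n : nat, (N <= n)%N ->
    eps n < (n%:R) ^- c'.

End QAC.

(* Main.v *)
(* Parities compose: cut n*m inputs into n blocks of m, run a parity circuit on
   each block in parallel, and feed the n output qubits to a parity circuit on n
   inputs, with fresh ancillas. On a basis input the state after the first phase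
   is a product over the blocks; up to a component of squared norm <= n*e' (union
   bound) all outputs are correct, and that part is |correct parities> tensored
   with garbage the second phase never touches, so no uncomputation is needed.
   A round with blocks of size M reducing r*M bits to r costs r*M^c ancillas.

   With n = t^(c(2^(K+1)-1)), reduce by c rounds of blocks of size t, then c
   rounds of size t^2, t^4, ..., t^(2^K). Each stage shrinks the number of bits
   enough to pay for squaring the block size, so every round costs at most
   n*t^(c-1) ancillas and the (K+1)c rounds together at most n*t^c, which is at
   most n^(1+2^-K), in depth (K+1)cd <= 2Kcd. *)

Require Import Defs.
From HB Require Import structures.
From mathcomp Require Import all_boot all_order all_algebra.
From mathcomp Require Import all_classical all_reals all_analysis.
From mathcomp Require Import complex.
From mathcomp Require Import zify ring.
Import Order.TTheory GRing.Theory Num.Theory.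
Local Open Scope ring_scope.
Set Implicit Arguments. Unset Strict Implicit. Unset Printing Implicit Defensive.

(** * Operator algebra, unitarity, circuits run one after the other, squared norms *)

Section Operators.
Variables (R : realType) (m : nat).
Local Notation C := R[i].
Implicit Types (A B : op R m) (g h : 'I_m -> qubit_gate R) (u v : qubit_gate R).

Lemma prodr_bool (S : comPzRingType) (I : finType) (P b : pred I) :
  \prod_(i | P i) (b i)%:R = [forall (i | P i), b i]%:R :> S.
Proof.
case: forallP => [Pb|/forallP].
  by rewrite big1 // => i Pi; have /implyP/(_ Pi) -> := Pb i.
rewrite negb_forall => /existsP[j]; rewrite negb_imply => /andP[Pj /negPf bj].
by rewrite (bigD1 j) //= bj mul0r.
Qed.

Definition op1 : op R m := fun x y => (x == y)%:R.

Definition adjop A : op R m := fun x y => conjc (A y x).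

Definition unitary_op A := opmul (adjop A) A = op1.

Definition gate1 : qubit_gate R := fun a b => (a == b)%:R.

Definition gate_mul u v : qubit_gate R := fun a b => \sum_(k : bool) u a k * v k b.

Lemma opmulA A B D : opmul A (opmul B D) = opmul (opmul A B) D.
Proof.
apply/funext => x; apply/funext => y; rewrite /opmul.
under eq_bigr do rewrite big_distrr /=.
rewrite exchange_big /=; apply: eq_bigr => z _.
by rewrite big_distrl /=; apply: eq_bigr => w _; rewrite mulrA.
Qed.

Lemma sum_eq_op (T : finType) (F : T -> C) (x : T) :
  \sum_z (x == z)%:R * F z = F x.
Proof.
rewrite (bigD1 x) //= eqxx mul1r big1 ?addr0 // => z /negPf.
by rewrite eq_sym => ->; rewrite mul0r.
Qed.

Lemma op1mul A : opmul op1 A = A.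
Proof. by apply/funext => x; apply/funext => y; rewrite /opmul sum_eq_op. Qed.

Lemma opmul1 A : opmul A op1 = A.
Proof.
apply/funext => x; apply/funext => y; rewrite /opmul /op1.
by under eq_bigr do rewrite mulrC eq_sym; rewrite sum_eq_op.
Qed.

Lemma adjopM A B : adjop (opmul A B) = opmul (adjop B) (adjop A).
Proof.
apply/funext => x; apply/funext => y; rewrite /adjop /opmul rmorph_sum /=.
by apply: eq_bigr => z _; rewrite rmorphM /= mulrC.
Qed.

Lemma unitary_opM A B : unitary_op A -> unitary_op B -> unitary_op (opmul A B).
Proof.
move=> uA uB; rewrite /unitary_op adjopM opmulA -(opmulA (adjop B)).
by rewrite uA opmul1.
Qed.

Lemma sq_layerM g h :
  opmul (sq_layer g) (sq_layer h) = sq_layer (fun i => gate_mul (g i) (h i)).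
Proof.
apply/funext => x; apply/funext => y; rewrite /opmul /sq_layer /gate_mul.
rewrite (bigA_distr_bigA (fun i k => g i (x i) k * h i k (y i))) /=.
by apply: eq_bigr => z _; rewrite -big_split.
Qed.

Lemma sq_layer1 : sq_layer (fun=> gate1) = op1.
Proof.
apply/funext => x; apply/funext => y; rewrite /sq_layer /gate1 /op1 prodr_bool.
congr (nat_of_bool _)%:R; apply/forallP/eqP => [e|-> i]; last by rewrite eqxx.
by apply/ffunP => i; exact/eqP/(e i).
Qed.

Lemma cz_layer0 : cz_layer R (finset.set0 : {set {set 'I_m}}) = op1.
Proof.
by apply/funext => x; apply/funext => y; rewrite /cz_layer /op1 big_set0; case: eqP.
Qed.

Lemma unitary_sq_layer g : (forall i, unitary1 (g i)) -> unitary_op (sq_layer g).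
Proof.
move=> ug; rewrite /unitary_op.
have -> : adjop (sq_layer g) = sq_layer (fun i a b => conjc (g i b a)).
  by apply/funext => x; apply/funext => y; rewrite /adjop /sq_layer rmorph_prod.
rewrite sq_layerM -sq_layer1; congr sq_layer; apply/funext => i.
by apply/funext => a; apply/funext => b; rewrite /gate_mul ug.
Qed.

Lemma unitary_cz_layer (P : {set {set 'I_m}}) : unitary_op (cz_layer R P).
Proof.
rewrite /unitary_op; apply/funext => x; apply/funext => y.
rewrite /opmul /adjop /cz_layer /op1 [LHS](bigD1 y) //= [X in _ + X]big1 ?addr0; last first.
  by move=> z /negPf zy; rewrite zy mulr0.
rewrite eqxx (eq_sym y x); case: (x =P y) => [xy|_]; last by rewrite conjc0 mul0r.
rewrite rmorph_prod /= -big_split /= big1 // => S _.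
by case: ifP => _; rewrite ?rmorphN rmorph1 ?mulrNN mulr1.
Qed.

Lemma unitary1_gate1 : unitary1 gate1.
Proof.
move=> a b; rewrite /gate1 big_bool /= !conjc_nat.
by case: a; case: b; rewrite /= ?(mulr0, mul0r, mulr1, addr0, add0r).
Qed.

Lemma unitary1M u v : unitary1 u -> unitary1 v -> unitary1 (gate_mul u v).
Proof.
move=> uu uv a b; rewrite -(uv a b) /gate_mul.
have E j k : \sum_l conjc (u l j) * u l k = (j == k)%:R by exact: uu.
transitivity (\sum_l \sum_j \sum_k conjc (v j a) * v k b * (conjc (u l j) * u l k)).
  apply: eq_bigr => l _; rewrite rmorph_sum /= big_distrl /=; apply: eq_bigr => j _.
  rewrite big_distrr /=; apply: eq_bigr => k _; rewrite rmorphM /=; ring.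
rewrite exchange_big /=; apply: eq_bigr => j _.
rewrite exchange_big /= -[RHS]mulr1.
rewrite -[RHS](_ : \sum_k (j == k)%:R * (conjc (v j a) * v k b) = _); last first.
  by rewrite sum_eq_op mulr1.
by apply: eq_bigr => k _; rewrite -mulr_sumr E mulrC.
Qed.

Lemma unitary_circuit d sq cz : valid_circuit (R := R) (m := m) d sq cz ->
  unitary_op (circuit_op sq cz d).
Proof.
move=> [usq _]; have : (d <= d)%N by [].
elim: {1 3}d => [|k IHk] kd /=; first exact/unitary_sq_layer/usq.
apply: unitary_opM; first exact/unitary_sq_layer/usq.
by apply: unitary_opM; [exact: unitary_cz_layer | exact/IHk/ltnW].
Qed.

(** The last single-qubit layer of the first circuit and the initial one of the second merge into
    one layer, a product of unitary gates being unitary. Hence the depths add exactly. *)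
Lemma circuit_op_seq d1 d2 sq1 cz1 sq2 cz2 :
  valid_circuit d1 sq1 cz1 -> valid_circuit d2 sq2 cz2 ->
  exists (sq : nat -> 'I_m -> qubit_gate R) cz, valid_circuit (d1 + d2) sq cz /\
    circuit_op sq cz (d1 + d2) =
      opmul (circuit_op sq2 cz2 d2) (circuit_op sq1 cz1 d1).
Proof.
move=> [u1 t1] [u2 t2].
pose sq k i := if (k < d1)%N then sq1 k i else
  if k == d1 then gate_mul (sq2 0 i) (sq1 d1 i) else sq2 (k - d1)%N i.
pose cz k := if (k <= d1)%N then cz1 k else cz2 (k - d1)%N.
exists sq, cz; split; first split.
- move=> k kd i; rewrite /sq; case: ltnP => k1; first by apply: u1; lia.
  by case: eqP => k2; [apply: unitary1M; [apply: u2 | apply: u1] | apply: u2; lia].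
- by move=> k kd; rewrite /cz; case: leqP => k1; [apply: t1 | apply: t2]; lia.
have seq1 k : (k < d1)%N -> circuit_op sq cz k = circuit_op sq1 cz1 k.
  elim: k => [|k IHk] kd /=; first by rewrite /sq kd.
  by rewrite IHk ?(ltnW kd) // /cz (ltnW kd) /sq kd.
elim: d2 {u2 t2} => [|k IHk] /=.
  rewrite addn0; case: d1 @sq @cz seq1 {u1 t1} => [|d1] sq cz seq1 /=.
    by rewrite sq_layerM /sq.
  rewrite [RHS]opmulA sq_layerM seq1 //.
  by congr opmul; [rewrite /sq ltnn eqxx | rewrite /cz leqnn].
rewrite addnS /= IHk -!opmulA; congr opmul; last congr opmul.
  congr sq_layer; apply/funext => i; rewrite /sq ltnNge leqW ?leq_addr //=.
  by rewrite -addnS addKn gtn_eqF // addnS ltnS leq_addr.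
by rewrite /cz leqNgt ltnS leq_addr /= -addnS addKn.
Qed.

(** The identity at an arbitrary depth serves to pad circuits, and as the depth-0 parity circuit on
    one bit. *)
Lemma circuit_op1 d :
  valid_circuit d (fun _ _ => gate1) (fun=> finset.set0 : {set {set 'I_m}}) /\
  circuit_op (fun _ _ => gate1) (fun=> finset.set0 : {set {set 'I_m}}) d = op1.
Proof.
split; first split=> *; [exact: unitary1_gate1 | |].
  apply/andP; split; last by rewrite inE.
  by apply/finset.trivIsetP => A B; rewrite inE.
by elim: d => [|d IHd] /=; rewrite sq_layer1 // IHd cz_layer0 !opmul1.
Qed.

Lemma sqnormE (z : C) : (sqnorm z)%:C%C = conjc z * z.
Proof. by case: z => a b; rewrite /sqnorm /=; simpc; congr (_ +i* _)%C; ring. Qed.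

Lemma sqnorm_ge0 (z : C) : 0 <= sqnorm z.
Proof. by rewrite addr_ge0 ?sqr_ge0. Qed.

Lemma sqnorm0 : sqnorm (0 : C) = 0.
Proof. by rewrite /sqnorm /= expr0n addr0. Qed.

Lemma sqnorm1 : sqnorm (1 : C) = 1.
Proof. by rewrite /sqnorm /= expr0n addr0 expr1n. Qed.

Lemma sqnormM (z w : C) : sqnorm (z * w) = sqnorm z * sqnorm w.
Proof. by case: z w => a b [c d]; rewrite /sqnorm /=; ring. Qed.

Lemma sqnorm_prod (I : finType) (F : I -> C) :
  sqnorm (\prod_i F i) = \prod_i sqnorm (F i).
Proof. by elim/big_rec2: _ => [|i x y _ <-]; rewrite ?sqnorm1 // sqnormM. Qed.

Lemma sqnorm_bool (b : bool) : sqnorm (b%:R : C) = b%:R.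
Proof. by case: b; rewrite ?sqnorm1 ?sqnorm0. Qed.

(** The parallelogram law with the term for [z - w] dropped. It is the source of the factor 2 in the
    error of a composed circuit. *)
Lemma sqnormD_le (z w : C) : sqnorm (z + w) <= 2 * (sqnorm z + sqnorm w).
Proof.
case: z w => a b [c d]; rewrite /sqnorm /= -subr_ge0.
suff -> : 2 * (a ^+ 2 + b ^+ 2 + (c ^+ 2 + d ^+ 2)) - ((a + c) ^+ 2 + (b + d) ^+ 2)
  = (a - c) ^+ 2 + (b - d) ^+ 2 by rewrite addr_ge0 ?sqr_ge0.
ring.
Qed.

(** In the complex numbers the left side expands to the quadratic form of [opmul (adjop A) A] at
    [psi]. It will carry the erroneous part of a state through the second phase. *)
Lemma unitary_norm A (psi : Defs.basis m -> C) : unitary_op A ->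
  \sum_x sqnorm (\sum_z A x z * psi z) = \sum_z sqnorm (psi z).
Proof.
move=> uA; apply: (@complexI R); rewrite !rmorph_sum /=.
transitivity (\sum_x \sum_z \sum_w conjc (psi z) * psi w * (adjop A z x * A x w)).
  apply: eq_bigr => x _; rewrite sqnormE rmorph_sum /= big_distrl /=.
  apply: eq_bigr => z _; rewrite big_distrr /=; apply: eq_bigr => w _.
  by rewrite rmorphM /= /adjop; ring.
rewrite exchange_big /=; apply: eq_bigr => z _; rewrite exchange_big /=.
transitivity (\sum_w (z == w)%:R * (conjc (psi z) * psi w)); last first.
  by rewrite sum_eq_op sqnormE.
apply: eq_bigr => w _; rewrite -mulr_sumr mulrC; congr (_ * _).
exact: (congr1 (fun F : op R m => F z w) uA).
Qed.

Lemma unitary_col A y : unitary_op A -> \sum_x sqnorm (A x y) = 1.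
Proof.
move=> uA; apply: (@complexI R); rewrite rmorph_sum /=.
transitivity (opmul (adjop A) A y y); last by rewrite uA /op1 eqxx.
by apply: eq_bigr => x _; rewrite sqnormE.
Qed.

End Operators.

(** * Parallel copies of a circuit on disjoint blocks of qubits *)

Section Lift.
Variables (R : realType) (B : finType) (p N : nat) (f : B -> 'I_p -> 'I_N).
Hypothesis f_inj : injective (fun bi : B * 'I_p => f bi.1 bi.2).
Implicit Types (x y z : Defs.basis N) (h : {ffun B -> Defs.basis p}).

(** The partial inverse of the placement [f]; [None] marks the qubits outside all blocks. *)
Definition block_of (q : 'I_N) : option (B * 'I_p) := [pick bi | f bi.1 bi.2 == q].

Definition restr (b : B) x : Defs.basis p := [ffun i => x (f b i)].

Definition agree x y := [forall (q | block_of q == None), x q == y q].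

Definition overwrite h x : Defs.basis N :=
  [ffun q => if block_of q is Some bi then h bi.1 bi.2 else x q].

Lemma block_ofE b i : block_of (f b i) = Some (b, i).
Proof.
rewrite /block_of; case: pickP => [bi /eqP e|/(_ (b, i))]; last by rewrite eqxx.
by congr Some; exact: (@f_inj bi (b, i) e).
Qed.

Lemma block_ofP q bi : block_of q = Some bi -> q = f bi.1 bi.2.
Proof. by rewrite /block_of; case: pickP => // ? /eqP <- [<-]. Qed.

Lemma restr_overwrite b h x : restr b (overwrite h x) = h b.
Proof. by apply/ffunP => i; rewrite !ffunE block_ofE. Qed.

Lemma agree_overwrite h x : agree x (overwrite h x).
Proof. by apply/forallP => q; apply/implyP => /eqP e; rewrite ffunE e. Qed.

Lemma agreeP x y :
  reflect (forall q, block_of q = None -> x q = y q) (agree x y).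
Proof.
apply: (iffP forallP) => e q; last by apply/implyP => /eqP/e ->.
by move=> bq; have := e q; rewrite bq => /eqP.
Qed.

Lemma agree_sym x y : agree x y = agree y x.
Proof. by apply/agreeP/agreeP => yz q /yz. Qed.

Lemma overwrite_restr x z : agree x z -> overwrite [ffun b => restr b z] x = z.
Proof.
move=> /agreeP e; apply/ffunP => q; rewrite ffunE.
case bq: (block_of q) => [bi|]; last exact: e.
by rewrite !ffunE -(block_ofP bq).
Qed.

Lemma eq_basis x y : (x == y) = [forall b, restr b x == restr b y] && agree x y.
Proof.
apply/eqP/andP => [->|[/forallP e /agreeP a]].
  by split; [apply/forallP | apply/agreeP].
apply/ffunP => q; case bq: (block_of q) => [bi|]; last exact: a.
by rewrite (block_ofP bq); have /eqP/ffunP/(_ bi.2) := e bi.1; rewrite !ffunE.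
Qed.

(** Fixing the qubits outside the blocks leaves one free choice of basis state per block, so the sum
    runs over functions [h] on blocks. Sums of products over blocks can then be factored. *)
Lemma sum_agree (S : nmodType) (F : Defs.basis N -> S) x :
  \sum_(z | agree x z) F z = \sum_h F (overwrite h x).
Proof.
rewrite (reindex_onto (fun h => overwrite h x) (fun z => [ffun b => restr b z])).
  apply: eq_bigl => h; rewrite agree_overwrite /=; apply/eqP/ffunP => b.
  by rewrite ffunE restr_overwrite.
by move=> z; exact: overwrite_restr.
Qed.

Lemma prod_blocks (S : comPzRingType) (F : 'I_N -> S) :
  \prod_q F q =
  (\prod_b \prod_i F (f b i)) * \prod_(q | block_of q == None) F q.
Proof.
rewrite (bigID (fun q => block_of q != None)) /=; congr (_ * _).
  rewrite pair_big /= (@reindex_omap _ _ _ _ _ (fun bi => f bi.1 bi.2) block_of).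
    by apply: eq_bigl => -[b i] /=; rewrite block_ofE eqxx.
  by move=> q; case bq: block_of => [bi|] //= _; rewrite -(block_ofP bq).
by apply: eq_bigl => q; rewrite negbK.
Qed.

(** The tensor power of [A], one factor per block, tensored with the identity on the remaining
    qubits. *)
Definition lift_op (A : op R p) : op R N :=
  fun x y => (\prod_b A (restr b x) (restr b y)) * (agree x y)%:R.

Definition lift_gates (g : 'I_p -> qubit_gate R) (q : 'I_N) : qubit_gate R :=
  if block_of q is Some bi then g bi.2 else @gate1 R.

Definition lift_sets (P : {set {set 'I_p}}) : {set {set 'I_N}} :=
  [set (f bS.1 @: bS.2) | bS : B * {set 'I_p} in finset.setX [set: B] P]%SET.

Lemma lift_opM (A D : op R p) :
  lift_op (opmul A D) = opmul (lift_op A) (lift_op D).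
Proof.
apply/funext => x; apply/funext => y; rewrite /opmul /lift_op.
transitivity (\sum_(z | agree x z) (\prod_b (A (restr b x) (restr b z) *
    D (restr b z) (restr b y))) * (agree x y)%:R : R[i]); last first.
  rewrite big_mkcond /=; apply: eq_bigr => z _.
  case: ifPn => [xz|_]; last by rewrite mulr0 mul0r.
  rewrite mulr1 big_split /= -mulrA; congr (_ * (_ * (nat_of_bool _)%:R)).
  by apply/agreeP/agreeP => e q bq; rewrite -(e q bq) ?(agreeP _ _ xz q bq).
rewrite -big_distrl /=; congr (_ * _); rewrite sum_agree.
rewrite (bigA_distr_bigA (fun b (w : Defs.basis p) => A (restr b x) w * D w (restr b y))) /=.
by apply: eq_bigr => h _; apply: eq_bigr => b _; rewrite restr_overwrite.
Qed.

Lemma lift_sq_layer g : lift_op (sq_layer g) = sq_layer (lift_gates g).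
Proof.
apply/funext => x; apply/funext => y; rewrite /lift_op /sq_layer prod_blocks.
congr (_ * _).
  apply: eq_bigr => b _; apply: eq_bigr => i _.
  by rewrite /lift_gates block_ofE !ffunE.
rewrite -prodr_bool; apply: eq_bigr => q /eqP bq.
by rewrite /lift_gates bq.
Qed.

(** Nonempty sets are required: the images of the empty set in all blocks coincide, so [lift_sets]
    would count one sign where the tensor power has one per block. For nonempty sets, the image
    determines both the block and the set. *)
Lemma lift_cz_layer (P : {set {set 'I_p}}) : (finset.set0 \notin P)%SET ->
  lift_op (cz_layer R P) = cz_layer R (lift_sets P).
Proof.
move=> P0; apply/funext => x; apply/funext => y; rewrite /lift_op /cz_layer.
rewrite eq_basis; case: (agree x y); rewrite ?andbF ?mulr0 // andbT mulr1.
case: forallP => [e|/forallP]; last first.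
  by move=> /forallPn[b /negPf bxy]; rewrite (bigD1 b) //= bxy mul0r.
rewrite /lift_sets big_imset /=; last first.
  move=> [b S] [b' S'] /finset.setXP[_ SP] /finset.setXP[_ SP'] /= eSS.
  have S_neq0 : S != finset.set0 by apply: contraNneq P0 => <-.
  have eb : b = b'.
    have [i iS] := finset.set0Pn _ S_neq0.
    have : f b i \in (f b' @: S')%SET by rewrite -eSS imset_f.
    by move=> /imsetP[j _ /(@f_inj (b, i) (b', j))[]].
  congr pair => //; rewrite -eb in eSS.
  by apply: imset_inj eSS => i j /(@f_inj (b, i) (b, j))[].
rewrite (eq_bigl (fun bS => (bS.1 \in [set: B]%SET) && (bS.2 \in P))); last first.
  by move=> [b S]; rewrite finset.in_setX.
rewrite -(pair_big (mem [set: B]%SET) (mem P) (fun b S =>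
  if [forall q in (f b @: S)%SET, x q] then -1 else 1)) /=.
apply: eq_big => [b|b _]; first by rewrite inE.
rewrite e; apply: eq_bigr => S _; congr (if _ then _ else _).
apply/forall_inP/forall_inP => [xS q /imsetP[i iS ->]|xS i iS].
  by have := xS i iS; rewrite ffunE.
by rewrite ffunE; apply/xS/imset_f.
Qed.

Lemma valid_cz_lift (P : {set {set 'I_p}}) : valid_cz P -> valid_cz (lift_sets P).
Proof.
move=> /andP[/finset.trivIsetP tP P0]; apply/andP; split; last first.
  apply/negP => /imsetP[[b S] /finset.setXP[_ SP]] /= /esym/eqP.
  by rewrite imset_eq0 => /eqP S0; rewrite -S0 SP in P0.
apply/finset.trivIsetP => Q Q' /imsetP[[b S] /finset.setXP[_ SP] ->].
move=> /imsetP[[b' S'] /finset.setXP[_ SP'] ->] /=; apply: contraNT.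
move=> /pred0Pn[q /andP[/= /imsetP[i iS ->]]].
move=> /imsetP[j jS /(@f_inj (b, i) (b', j))[<- eij]].
rewrite -eij in jS; case: (eqVneq S S') => [-> //|/(tP _ _ SP SP')].
by move=> /pred0P/(_ i); rewrite /= iS jS.
Qed.

Lemma lift_circuit d sq cz : valid_circuit (R := R) (m := p) d sq cz ->
  valid_circuit d (fun k => lift_gates (sq k)) (fun k => lift_sets (cz k)) /\
  circuit_op (fun k => lift_gates (sq k)) (fun k => lift_sets (cz k)) d =
    lift_op (circuit_op sq cz d).
Proof.
move=> [usq vcz]; split; first split.
- move=> k kd q; rewrite /lift_gates; case: block_of => [bi|]; first exact: usq.
  exact: unitary1_gate1.
- by move=> k kd; apply/valid_cz_lift/vcz.
have : (d <= d)%N by [].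
elim: {1 3 4}d => [|k IHk] kd /=; first by rewrite lift_sq_layer.
rewrite !lift_opM lift_sq_layer lift_cz_layer ?IHk //; first exact: ltnW.
by have /andP[] := vcz k.+1 kd.
Qed.

End Lift.

(** * Error analysis of block parities followed by the parity of their outputs *)

Section Compose.
Variables (R : realType) (n m a a' N : nat).
Variables (U : op R (n + a)) (U' : op R (m + a')) (e e' : R).
Variables (f : 'I_n -> 'I_(m + a') -> 'I_N) (g : unit -> 'I_(n + a) -> 'I_N).
Variables (x : 'I_n -> {ffun 'I_m -> bool}) (X0 : Defs.basis N).
Hypotheses (f_inj : injective (fun bi : 'I_n * 'I_(m + a') => f bi.1 bi.2))
  (g_inj : injective (fun bi : unit * 'I_(n + a) => g bi.1 bi.2))
  (unitary_U' : unitary_op U') (unitary_liftU : unitary_op (lift_op g U))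
  (unitary_liftU' : unitary_op (lift_op f U'))
  (restr_X0 : forall i, restr f i X0 = init_state a' (x i))
  (X0_anc : forall k, X0 (g tt (rshift n k)) = false)
  (first_bit_f : forall z i, first_bit (restr f i z) = z (g tt (lshift a i)))
  (block_anc : forall k, block_of f (g tt (rshift n k)) = None)
  (first_bit_g : forall z, first_bit (restr g tt z) = first_bit z)
  (U_parity : computes_parity U e) (U'_parity : computes_parity U' e').

(* Psi is the state after the first phase on the input X0; its good part has all
   block outputs correct. *)
Let pars : {ffun 'I_n -> bool} := [ffun i => parity (x i)].
Let good (z : Defs.basis N) := [forall i, first_bit (restr f i z) == pars i].
Let Psi (z : Defs.basis N) := lift_op f U' z X0.

Lemma sqnorm_Psi z : sqnorm (Psi z) =
  (\prod_i sqnorm (U' (restr f i z) (init_state a' (x i)))) * (agree f X0 z)%:R.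
Proof.
rewrite /Psi /lift_op sqnormM sqnorm_bool sqnorm_prod agree_sym.
by congr (_ * _); apply: eq_bigr => i _; rewrite restr_X0.
Qed.

(** Union bound over the block that errs. For a fixed block [i] the weight is a product over blocks:
    every other factor sums to 1, a column of a unitary, and the factor of [i] sums to the error
    probability of [U'] on [x i]. *)
Lemma bad_norm_le : \sum_(z | ~~ good z) sqnorm (Psi z) <= n%:R * e'.
Proof.
pose W i (y : Defs.basis (m + a')) := sqnorm (U' y (init_state a' (x i))).
pose wrong i (y : Defs.basis (m + a')) := first_bit y == ~~ pars i.
have W_ge0 i y : 0 <= W i y by exact: sqnorm_ge0.
have P_ge0 z : 0 <= \prod_b W b (restr f b z) by apply: prodr_ge0 => *.
have -> : n%:R * e' = \sum_(i < n) e' by rewrite sumr_const card_ord mulr_natl.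
apply: (@le_trans _ _ (\sum_(i < n) \sum_(z | agree f X0 z)
    (\prod_b W b (restr f b z)) * (wrong i (restr f i z))%:R)).
  rewrite exchange_big /= big_mkcond [leRHS]big_mkcond /=.
  apply: ler_sum => z _; rewrite sqnorm_Psi.
  case: ifP => [|_]; last by case: ifP => // _; apply: sumr_ge0 => i _; rewrite mulr_ge0.
  rewrite negb_forall => /existsP[j bad_j]; case: (agree f X0 z); last by rewrite mulr0.
  have wrong_j : wrong j (restr f j z).
    by move: bad_j; rewrite /wrong; case: first_bit; case: (pars j).
  rewrite mulr1 [leRHS](bigD1 j) //= wrong_j mulr1 lerDl.
  by apply: sumr_ge0 => i _; rewrite mulr_ge0.
apply: ler_sum => i _; rewrite (sum_agree f_inj).
(* The indicator of an error is absorbed into the factor of block [i], so that the sum over [h]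
   becomes a product of sums. *)
pose G b y := W b y * (if b == i then (wrong i y)%:R else 1).
rewrite (eq_bigr (fun h : {ffun _ -> _} => \prod_b G b (h b))); last first.
  move=> h _; rewrite (restr_overwrite f_inj) /G big_split /= -big_mkcond big_pred1_eq.
  by congr (_ * _); apply: eq_bigr => b _; rewrite (restr_overwrite f_inj).
rewrite -bigA_distr_bigA (bigD1 i) //= [X in _ * X]big1 => [|b /negPf bi]; last first.
  rewrite /G bi -[RHS](unitary_col (init_state a' (x b)) unitary_U').
  by apply: eq_bigr => y _; rewrite mulr1.
rewrite mulr1; apply: le_trans (U'_parity (x i)).
rewrite /out_prob [leRHS]big_mkcond /= le_eqVlt; apply/orP; left; apply/eqP.
apply: eq_bigr => y _; rewrite /G eqxx /wrong ffunE.
by case: ifP => _; rewrite ?mulr1 ?mulr0.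
Qed.

(** On the good part the second circuit sees exactly [init_state a pars]: its inputs are the correct
    block parities and its ancillas lie outside the blocks, still 0. All other qubits are garbage
    that it leaves fixed, so each garbage state contributes its weight times an error probability of
    [U]. *)
Lemma good_out_le : \sum_(w | first_bit w == ~~ parity pars)
    sqnorm (\sum_z lift_op g U w z * (Psi z * (good z)%:R)) <= e.
Proof.
pose q := init_state a pars; pose hq : {ffun unit -> Defs.basis (n + a)} := [ffun=> q].
pose z0 w := overwrite g hq w.
have Psi_q z : Psi z * (good z)%:R != 0 -> restr g tt z = q.
  case: (boolP (good z)) => [gz|_]; last by rewrite mulr0 eqxx.
  rewrite /Psi /lift_op; case: (boolP (agree _ _ _)) => [/agreeP az _|]; last first.
    by rewrite mulr0 mul0r eqxx.
  apply/ffunP => j; rewrite !ffunE; case: split_ordP => k ->.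
    by rewrite -first_bit_f (eqP (forallP gz k)).
  by rewrite az ?block_anc // X0_anc.
(* A contributing [z] agrees with [w] off the qubits of [g] and equals [q] on them, so [z0 w] is the
   only candidate. *)
have V_good w : \sum_z lift_op g U w z * (Psi z * (good z)%:R) =
    U (restr g tt w) q * (Psi (z0 w) * (good (z0 w))%:R).
  rewrite (bigD1 (z0 w)) //= big1 ?addr0 => [|z].
    rewrite /lift_op agree_overwrite // mulr1 (big_pred1 tt) => [|[]] //.
    by rewrite (restr_overwrite g_inj) ffunE.
  apply: contraNeq; rewrite mulf_eq0 negb_or => /andP[].
  rewrite /lift_op; case: (boolP (agree _ _ _)) => [wz _ /Psi_q zq|]; last first.
    by rewrite mulr0 eqxx.
  rewrite -(overwrite_restr wz); apply/eqP; congr overwrite.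
  by apply/ffunP => -[]; rewrite !ffunE.
have e_ge0 : 0 <= e.
  by apply: le_trans (U_parity pars); apply: sumr_ge0 => *; exact: sqnorm_ge0.
pose G z := sqnorm (Psi z * (good z)%:R).
have G_ge0 z : 0 <= G z by exact: sqnorm_ge0.
under eq_bigr do rewrite V_good sqnormM.
(* Group the outputs [w] by garbage state; each group has error weight at most [e * G z], and the
   weights [G z] sum to at most 1. *)
rewrite (partition_big z0 predT) //=.
apply: (@le_trans _ _ (\sum_z e * G z)).
  apply: ler_sum => z _.
  rewrite (eq_bigr (fun w => sqnorm (U (restr g tt w) q) * G z)); last first.
    by move=> w /andP[_ /eqP <-].
  rewrite -big_distrl ler_wpM2r //= -[leRHS]mul1r.
  apply: le_trans (_ : \sum_(w | agree g z w && (first_bit w == ~~ parity pars))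
     sqnorm (U (restr g tt w) q) <= _).
    rewrite [leLHS]big_mkcond [leRHS]big_mkcond; apply: ler_sum => w _.
    case: (first_bit w == _) => //=; rewrite ?andbF //.
    case: eqP => [<-|_]; last by case: ifP => // _; exact: sqnorm_ge0.
    by rewrite agree_sym agree_overwrite.
  rewrite big_mkcondr (sum_agree g_inj) mul1r.
  apply: le_trans (U_parity pars); rewrite /out_prob [leRHS]big_mkcond.
  rewrite [leRHS](reindex (fun h : {ffun unit -> Defs.basis (n + a)} => h tt)) /=.
    by apply: ler_sum => h _; rewrite -first_bit_g (restr_overwrite g_inj).
  exists (fun y => [ffun=> y]) => [h _|y _]; last by rewrite ffunE.
  by apply/ffunP => -[]; rewrite ffunE.
rewrite -mulr_sumr -[leRHS]mulr1 ler_wpM2l //.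
rewrite -(unitary_col X0 unitary_liftU'); apply: ler_sum => z _.
rewrite /G sqnormM sqnorm_bool -/(Psi z).
by case: (good z); rewrite ?mulr1 // mulr0 sqnorm_ge0.
Qed.

(** The final state is the sum [Vg + Vb] of the images of the good and bad parts. The good part is
    bounded through its wrong outputs, the bad part through its whole norm. *)
Lemma compose_out_le : \sum_(w | first_bit w == ~~ parity pars)
    sqnorm (opmul (lift_op g U) (lift_op f U') w X0) <= 2 * (e + n%:R * e').
Proof.
pose Vg w := \sum_z lift_op g U w z * (Psi z * (good z)%:R).
pose Vb w := \sum_z lift_op g U w z * (Psi z * (~~ good z)%:R).
apply: (@le_trans _ _ (\sum_(w | first_bit w == ~~ parity pars)
    2 * (sqnorm (Vg w) + sqnorm (Vb w)))).
  apply: ler_sum => w _; apply: le_trans (sqnormD_le _ _); rewrite -big_split /=.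
  rewrite le_eqVlt; apply/orP; left; apply/eqP; congr sqnorm.
  apply: eq_bigr => z _; rewrite -!mulrDr -/(Psi z).
  by case: (good z); rewrite ?addr0 ?add0r mulr1.
rewrite -mulr_sumr ler_wpM2l // big_split lerD //; first exact: good_out_le.
apply: le_trans bad_norm_le.
apply: (@le_trans _ _ (\sum_w sqnorm (Vb w))).
  rewrite [leLHS]big_mkcond; apply: ler_sum => w _.
  by case: ifP => // _; exact: sqnorm_ge0.
rewrite unitary_norm // [leRHS]big_mkcond; apply: ler_sum => z _.
by rewrite sqnormM sqnorm_bool; case: (good z); rewrite /= ?mulr1 ?mulr0.
Qed.

End Compose.

(** * Cutting the input into blocks, and operations on parity circuits *)

Section PairOrd.
Variables n m : nat.

Lemma pair_ord_subproof (i : 'I_n) (j : 'I_m) : (i * m + j < n * m)%N.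
Proof.
rewrite (leq_trans (n := i.+1 * m)) ?leq_mul2r ?ltn_ord ?orbT //.
by rewrite mulSnr ltn_add2l.
Qed.

Definition pair_ord i j : 'I_(n * m) := Ordinal (pair_ord_subproof i j).

Lemma pair_ord_inj : injective (fun ij : 'I_n * 'I_m => pair_ord ij.1 ij.2).
Proof.
move=> [i j] [i' j'] /(congr1 val) /= e.
have m_gt0 : (0 < m)%N := leq_ltn_trans (leq0n j) (ltn_ord j).
have := congr1 (divn^~ m) e; have := congr1 (modn^~ m) e.
rewrite !divnMDl // !modnMDl !divn_small // !modn_small // !addn0.
by move=> /val_inj -> /val_inj ->.
Qed.

Lemma pair_ord_bij : bijective (fun ij : 'I_n * 'I_m => pair_ord ij.1 ij.2).
Proof. by apply: inj_card_bij pair_ord_inj _; rewrite card_prod !card_ord. Qed.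

Lemma parity_blocks (x : {ffun 'I_(n * m) -> bool}) :
  parity x = parity [ffun i : 'I_n => parity [ffun j => x (pair_ord i j)]].
Proof.
rewrite /parity (reindex _ (onW_bij _ pair_ord_bij)) /=.
rewrite -(pair_big predT predT (fun i j => x (pair_ord i j))) /=.
by apply: eq_bigr => i _; rewrite ffunE; apply: eq_bigr => j _; rewrite ffunE.
Qed.

End PairOrd.

Lemma first_bitE m (y : Defs.basis m) (o : 'I_m) : val o = 0%N -> first_bit y = y o.
Proof.
move=> o0; apply/existsP/idP => [[i /andP[/eqP i0]]|yo]; last by exists o; rewrite o0.
by rewrite (_ : i = o) //; apply: val_inj; rewrite i0.
Qed.

Lemma QAC0_parity_compose (R : realType) n m a a' d d' (e e' : R) :
  (0 < n)%N -> (0 < m)%N -> QAC0_parity d n a e -> QAC0_parity d' m a' e' ->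
  QAC0_parity (d' + d) (n * m) (n * a' + a) (2 * (e + n%:R * e')).
Proof.
move=> n_gt0 m_gt0 [sq [cz [v U_parity]]] [sq' [cz' [v' U'_parity]]].
(* Layout of the qubits: [n * m] inputs, then [n * a'] ancillas shared out among the blocks, then
   [a] fresh ancillas for the second phase. *)
pose f (i : 'I_n) (j : 'I_(m + a')) : 'I_(n * m + (n * a' + a)) :=
  match fintype.split j with
  | inl j => lshift _ (pair_ord i j)
  | inr k => rshift _ (lshift _ (pair_ord i k))
  end.
have fl i j : f i (lshift a' j) = lshift _ (pair_ord i j).
  by rewrite /f (unsplitK (inl j)).
have fr i k : f i (rshift m k) = rshift _ (lshift _ (pair_ord i k)).
  by rewrite /f (unsplitK (inr k)).
(* A block returns its parity on its qubit [o], which becomes an input of the second circuit. For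
   block 0 this is the first qubit overall, so the final output is where it is measured. The index
   type [unit] makes the second circuit a lift with a single block. *)
pose o := Ordinal m_gt0.
pose g (_ : unit) (j : 'I_(n + a)) : 'I_(n * m + (n * a' + a)) :=
  match fintype.split j with
  | inl i => lshift _ (pair_ord i o)
  | inr k => rshift _ (rshift _ k)
  end.
have gl i : g tt (lshift a i) = lshift _ (pair_ord i o).
  by rewrite /g (unsplitK (inl i)).
have gr k : g tt (rshift n k) = rshift _ (rshift _ k).
  by rewrite /g (unsplitK (inr k)).
have f_inj : injective (fun bi : 'I_n * 'I_(m + a') => f bi.1 bi.2).
  move=> [i j] [i' j'] /=.
  case: (split_ordP j) => k ->; case: (split_ordP j') => k' ->; rewrite ?fl ?fr.
  - by move=> /lshift_inj /(@pair_ord_inj _ _ (i, k) (i', k')) [-> ->].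
  - by move=> /eqP; rewrite eq_lrshift.
  - by move=> /eqP; rewrite eq_rlshift.
  - by move=> /rshift_inj /lshift_inj /(@pair_ord_inj _ _ (i, k) (i', k')) [-> ->].
have g_inj : injective (fun bi : unit * 'I_(n + a) => g bi.1 bi.2).
  move=> [[] j] [[] j'] /=.
  case: (split_ordP j) => k ->; case: (split_ordP j') => k' ->; rewrite ?gl ?gr.
  - by move=> /lshift_inj /(@pair_ord_inj _ _ (k, o) (k', o)) [->].
  - by move=> /eqP; rewrite eq_lrshift.
  - by move=> /eqP; rewrite eq_rlshift.
  - by move=> /rshift_inj /rshift_inj ->.
have [vf fE] := lift_circuit f_inj v'; have [vg gE] := lift_circuit g_inj v.
have [sq'' [cz'' [v'' UE]]] := circuit_op_seq vf vg.
exists sq'', cz''; split=> // x; rewrite /out_prob UE fE gE parity_blocks.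
apply: (compose_out_le f_inj g_inj) => //.
- exact: unitary_circuit.
- by rewrite -gE; exact: unitary_circuit.
- by rewrite -fE; exact: unitary_circuit.
- move=> i; apply/ffunP => j; rewrite !ffunE.
  case: (split_ordP j) => k ->; first by rewrite fl (unsplitK (inl _)) ffunE.
  by rewrite fr (unsplitK (inr _)).
- by move=> k; rewrite ffunE gr (unsplitK (inr _)).
- by move=> z i; rewrite (@first_bitE _ _ (lshift a' o)) // ffunE fl gl.
- move=> k; rewrite gr; case bk: block_of => [[i j]|] //.
  have := block_ofP bk; rewrite /=; case: (split_ordP j) => l ->; rewrite ?fl ?fr.
    by move=> /eqP; rewrite eq_rlshift.
  by move=> /rshift_inj/eqP; rewrite eq_rlshift.
- move=> z; rewrite (@first_bitE _ _ (lshift a (Ordinal n_gt0))) // ffunE gl.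
  by rewrite -first_bitE.
Qed.

Lemma QAC0_parity_pad (R : realType) n a d d' (e : R) : (d <= d')%N ->
  QAC0_parity d n a e -> QAC0_parity d' n a e.
Proof.
move=> dd' [sq [cz [v U_parity]]]; have [v1 E1] := @circuit_op1 R (n + a) (d' - d).
have [sq' [cz' [v' UE]]] := circuit_op_seq v v1.
by rewrite subnKC // in v' UE; exists sq', cz'; rewrite UE E1 op1mul.
Qed.

Lemma QAC0_parity_le (R : realType) n a d (e e' : R) : e <= e' ->
  QAC0_parity d n a e -> QAC0_parity d n a e'.
Proof.
move=> ee' [sq [cz [v U_parity]]]; exists sq, cz; split=> // x.
exact: le_trans (U_parity x) ee'.
Qed.

Lemma QAC0_parity_ge0 (R : realType) n a d (e : R) : QAC0_parity d n a e -> 0 <= e.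
Proof.
move=> [sq [cz [v U_parity]]]; apply: le_trans (U_parity [ffun=> false]).
by apply: sumr_ge0 => *; exact: sqnorm_ge0.
Qed.

Lemma QAC0_parity1 (R : realType) : QAC0_parity 0 1 0 (0 : R).
Proof.
have [v E] := @circuit_op1 R (1 + 0) 0; exists (fun _ _ => @gate1 R), (fun=> finset.set0).
split=> // x; rewrite /out_prob E big1 // => y /eqP y0; rewrite /op1.
case: eqP => [yx|_]; last by rewrite sqnorm0.
move: y0; rewrite yx (@first_bitE _ _ (lshift 0 ord0)) // ffunE (unsplitK (inl _)).
by rewrite /parity big_ord1; case: (x ord0).
Qed.

(** * Ancillas and error over the rounds of repeatedly squared block sizes *)

Section Schedule.
Variables (R : realType) (d c t K : nat) (delta : R).
Hypotheses (t_gt0 : (0 < t)%N) (c_gt0 : (0 < c)%N)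
  (block : forall s, (s <= K)%N ->
     QAC0_parity d (t ^ 2 ^ s) ((t ^ 2 ^ s) ^ c) delta).

(** State after [J] rounds, built from the output end. The factor [t] in [a * t] expresses a cost of
    at most t^(c*2^(K+1) - 1) ancillas per round without subtraction; [b] counts accumulated errors
    [delta]. *)
Let reach (J e : nat) := exists a b : nat,
  [/\ (a * t <= J * t ^ (c * 2 ^ K.+1))%N, (b <= 4 ^ J * t ^ e)%N
    & QAC0_parity (J * d) (t ^ e) a (b%:R * delta)].

Lemma reach0 : reach 0 0.
Proof. by exists 0%N, 0%N; split=> //; rewrite mul0r; exact: QAC0_parity1. Qed.

(** A layer of blocks of size t^(2^s) is put in front of the circuit on t^e bits. Its t^(e + 2^s*c)
    ancillas fit by [room]. The new error count 2(b + t^e) is at most 4 * 4^J * t^e, whence the base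
    4. *)
Lemma reachS J e s : (s <= K)%N -> (e + 2 ^ s * c + 1 <= c * 2 ^ K.+1)%N ->
  reach J e -> reach J.+1 (e + 2 ^ s).
Proof.
move=> sK room [a [b [a_le b_le par]]].
exists (t ^ e * (t ^ 2 ^ s) ^ c + a)%N, (2 * (b + t ^ e))%N; split.
- rewrite mulnDl mulSn leq_add // -expnM -expnD -expnSr leq_pexp2l //; lia.
- rewrite expnD expnS mulnA.
  have := expn_gt0 4 J; have : (0 < t ^ 2 ^ s)%N by rewrite expn_gt0 t_gt0.
  have : (0 < t ^ e)%N by rewrite expn_gt0 t_gt0.
  move: (t ^ e)%N (t ^ 2 ^ s)%N (4 ^ J)%N b_le => u w v b_le u0 w0 /= v0.
  have : (u <= v * u)%N by rewrite leq_pmull.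
  have : (v * u <= v * u * w)%N by rewrite leq_pmulr.
  have -> : (4 * v * u * w = 4 * (v * u * w))%N by rewrite !mulnA.
  lia.
- rewrite expnD mulSn natrM natrD -mulrA (mulrDl b%:R).
  by apply: (QAC0_parity_compose _ _ par (block sK)); rewrite expn_gt0 t_gt0.
Qed.

(** The bound on [e] is what the last of [c] rounds needs, when [c - 1] of them have already
    enlarged the exponent. *)
Lemma reach_stage J e s r : (s <= K)%N -> (r <= c)%N ->
  (e + 2 ^ s * (2 * c - 1) + 1 <= c * 2 ^ K.+1)%N ->
  reach J e -> reach (J + r) (e + 2 ^ s * r).
Proof.
move=> sK rc room PJ; elim: r rc => [|r IHr] rc; first by rewrite muln0 !addn0.
rewrite addnS mulnSr addnA; apply: reachS => //; last exact/IHr/ltnW.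
have : (2 ^ s * (r + c) <= 2 ^ s * (2 * c - 1))%N by rewrite leq_mul2l; lia.
by rewrite mulnDr; lia.
Qed.

(** Stages run from [s = K] down, since the largest blocks are nearest the output. Stage [s] starts
    at exponent c*(2^(K+1) - 2*2^s), leaving a slack of exactly 2^s - 1 in the bound of
    [reach_stage]. *)
Lemma reach_stages i : (i <= K.+1)%N ->
  reach (i * c) (c * (2 ^ K.+1 - 2 ^ (K.+1 - i))).
Proof.
elim: i => [_|i IHi iK]; first by rewrite subn0 subnn muln0; exact: reach0.
have w_gt0 : (0 < 2 ^ (K - i))%N by rewrite expn_gt0.
have w_le : (2 * 2 ^ (K - i) <= 2 ^ K.+1)%N by rewrite -expnS leq_exp2l //; lia.
have := IHi (ltnW iK); rewrite subSS (subSn (iK : (i <= K)%N)).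
rewrite (expnS _ (K - i)) (mulSnr i).
have := leq_subr i K; move: (K - i)%N w_gt0 w_le => s w_gt0 w_le sK Pi.
have -> : (c * (2 ^ K.+1 - 2 ^ s) = c * (2 ^ K.+1 - 2 * 2 ^ s) + 2 ^ s * c)%N.
  by rewrite (mulnC (2 ^ s)%N) -mulnDr; congr muln; lia.
apply: reach_stage => //.
move: (2 ^ s)%N (2 ^ K.+1)%N w_gt0 w_le => w Q w_gt0 w_le.
have [q ->] : exists q, Q = (2 * w + q)%N by exists (Q - 2 * w)%N; lia.
rewrite addKn; nia.
Qed.

End Schedule.

(** * The error as a function of the input length, and its negligibility *)

Section CeilRoot.
Variable E : nat.
Hypothesis E_gt0 : (0 < E)%N.

Lemma ceil_root_subproof n : exists t, (n <= t ^ E)%N.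
Proof. by exists n; case: n => // n; rewrite -{1}(expn1 n.+1) leq_pexp2l. Qed.

(** Negligibility concerns all large [n], while circuits are built only for [n = t ^ E]; rounding
    the root up recovers [t] there and still bounds [n] by a power of the root elsewhere. *)
Definition ceil_root n := ex_minn (ceil_root_subproof n).

Lemma ceil_root_le n : (n <= ceil_root n ^ E)%N.
Proof. by rewrite /ceil_root; case: ex_minnP. Qed.

Lemma ceil_rootX t : ceil_root (t ^ E) = t.
Proof.
rewrite /ceil_root; case: ex_minnP => u tu /(_ t (leqnn _)) ut.
by apply/eqP; rewrite eqn_leq ut -(leq_exp2r _ _ E_gt0).
Qed.

End CeilRoot.

Section NegligibleError.
Variables (R : realType) (eps : nat -> R) (A E K : nat).
Hypothesis E_gt0 : (0 < E)%N.

Definition composed_error n : R :=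
  (A * n)%:R * \sum_(s < K.+1) eps (ceil_root E_gt0 n ^ 2 ^ s).

Lemma negl_composed_error : negl eps -> negl composed_error.
Proof.
move=> eps_negl k; have [N1 epsN1] := eps_negl (E * k.+2)%N.
(* The first summand forces the root to be at least [N1], the others give [A * K.+1 < n]. *)
exists (N1 ^ E + A * K.+1 + 1)%N => n nN; rewrite /composed_error.
set r := ceil_root E_gt0 n; have nr : (n <= r ^ E)%N := ceil_root_le E_gt0 n.
have r_gt0 : (0 < r)%N by case: r nr => //; rewrite exp0n //; lia.
have N1r : (N1 <= r)%N.
  by rewrite leqNgt; apply/negP => /ltnW; rewrite -(leq_exp2r _ _ E_gt0); lia.
have n_gt0 : (0 < n)%N by lia.
have nR_gt0 : 0 < n%:R :> R by rewrite ltr0n.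
have eps_le s : eps (r ^ 2 ^ s) <= n%:R ^- k.+2.
  have r_le : (r <= r ^ 2 ^ s)%N by rewrite -{1}(expn1 r) leq_pexp2l // expn_gt0.
  apply: le_trans (ltW (epsN1 _ (leq_trans N1r r_le))) _.
  rewrite exprM lef_pV2 ?posrE ?exprn_gt0 // ?ltr0n ?(leq_trans r_gt0) //.
  rewrite lerXn2r ?nnegrE ?exprn_ge0 ?ler0n // -natrX ler_nat.
  by rewrite (leq_trans nr) // leq_exp2r.
apply: (@le_lt_trans _ _ ((A * n)%:R * (K.+1%:R * n%:R ^- k.+2))).
  rewrite ler_wpM2l // mulr_natl -[X in _ *+ X](card_ord K.+1) -sumr_const.
  exact: ler_sum.
rewrite mulrA -natrM ltr_pdivrMr ?exprn_gt0 // !exprS.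
rewrite [n%:R * (n%:R * _)]mulrA [_ * n%:R ^+ k]mulrC mulrA mulVf ?mul1r; last first.
  by rewrite expf_neq0 // gt_eqF.
by rewrite -natrM ltr_nat mulnAC ltn_pmul2r; lia.
Qed.

End NegligibleError.

(** The left side is n * t^c, and t^c is the 2^K-th root of t^(c*2^K), which is at most [n] because
    2^K <= 2^(K+1) - 1. *)
Lemma natX_le_powR (R : realType) (t c K : nat) : (0 < t)%N -> (0 < c)%N ->
  (t ^ (c * 2 ^ K.+1))%:R <=
    ((t ^ (c * (2 ^ K.+1 - 1)))%:R : R) `^ (1 + 2 ^- K).
Proof.
move=> t_gt0 c_gt0; set n := (t ^ (c * (2 ^ K.+1 - 1)))%N.
have n_gt0 : (0 < n)%N by rewrite expn_gt0 t_gt0.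
have -> : (t ^ (c * 2 ^ K.+1) = n * t ^ c)%N.
  rewrite -expnD -mulnSr; congr (t ^ (c * _))%N.
  by rewrite subn1 prednK // expn_gt0.
rewrite powRD; last by rewrite pnatr_eq0 -lt0n n_gt0 implybT.
rewrite powRr1 // natrM ler_wpM2l //.
have -> : (t ^ c)%:R = ((t ^ c) ^ 2 ^ K)%:R `^ (2 ^- K) :> R.
  by rewrite (natrX _ (t ^ c)) -powR_mulrn // -powRrM (natrX _ 2 K) mulfV ?powRr1.
rewrite ge0_ler_powR ?nnegrE ?invr_ge0 ?exprn_ge0 // ler_nat -expnM.
rewrite leq_pexp2l // leq_mul2l expnS; apply/orP; right.
by have := expn_gt0 2 K; lia.
Qed.

Theorem theorem5p2 :
  exists C0 : nat, forall (R : realType) (d c N0 : nat),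
    (0 < d)%N -> (0 < c)%N -> (0 < N0)%N ->
    (exists eps : nat -> R, negl eps /\
       forall n : nat, (N0 <= n)%N -> QAC0_parity d n (n ^ c) (eps n)) ->
    exists D : nat, (D <= C0 * (c * d))%N /\
      forall K : nat, (1 <= K)%N ->
        exists eps' : nat -> R, negl eps' /\
          forall N : nat, exists n : nat, (N <= n)%N /\
            exists a : nat,
              (a%:R <= (n%:R : R) `^ (1 + 2 ^- K)) /\
              QAC0_parity (K * D) n a (eps' n).
Proof.
(* The constant 2 comes from (K+1)cd <= 2Kcd, valid as [K] is at least 1. *)
exists 2%N => R d c N0 d_gt0 c_gt0 N0_gt0 [eps [eps_negl par]].
exists (2 * (c * d))%N; split=> // K K_gt0.
pose J := (K.+1 * c)%N; pose E := (c * (2 ^ K.+1 - 1))%N.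
have E_gt0 : (0 < E)%N.
  by rewrite muln_gt0 c_gt0 subn_gt0 -{1}(expn0 2) ltn_exp2l.
exists (composed_error eps (4 ^ J) K E_gt0); split; first exact: negl_composed_error.
(* [N] makes the input long enough, [N0] makes the given circuits available at every block size, and
   [J] lets the spare factor [t] absorb the number of rounds in the ancilla bound. *)
move=> N; pose t := (N + N0 + J)%N; have t_gt0 : (0 < t)%N by rewrite /t; lia.
have le_tX e : (0 < e)%N -> (t <= t ^ e)%N.
  by move=> e_gt0; rewrite -{1}(expn1 t) leq_pexp2l.
have par_t s : QAC0_parity d (t ^ 2 ^ s) ((t ^ 2 ^ s) ^ c) (eps (t ^ 2 ^ s)%N).
  by apply: par; rewrite (leq_trans _ (le_tX _ _)) ?expn_gt0 // /t; lia.
exists (t ^ E)%N; split; first by rewrite (leq_trans _ (le_tX _ E_gt0)) // /t; lia.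
(* A sum of nonnegative errors dominates each of them, so one [delta] serves all block sizes. *)
pose delta := \sum_(s < K.+1) eps (t ^ 2 ^ s)%N.
have eps_ge0 s : 0 <= eps (t ^ 2 ^ s)%N by exact: QAC0_parity_ge0 (par_t s).
have block s : (s <= K)%N -> QAC0_parity d (t ^ 2 ^ s) ((t ^ 2 ^ s) ^ c) delta.
  move=> sK; apply: QAC0_parity_le (par_t s).
  by rewrite /delta (bigD1 (Ordinal (sK : (s < K.+1)%N))) //= lerDl sumr_ge0.
have := reach_stages t_gt0 c_gt0 block (leqnn K.+1).
rewrite subnn expn0 -/E -/J => -[a [b [a_le b_le par_a]]].
exists a; split.
  apply: le_trans (natX_le_powR R K t_gt0 c_gt0); rewrite ler_nat.
  rewrite -(leq_pmul2r t_gt0) (leq_trans a_le) // mulnC leq_mul2l /t leq_addl.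
  by rewrite orbT.
apply: (@QAC0_parity_pad _ _ _ (J * d)); first by rewrite /J; nia.
apply: QAC0_parity_le par_a; rewrite /composed_error ceil_rootX.
by rewrite ler_wpM2r ?sumr_ge0 // ler_nat.
Qed.
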